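(* Let $A$ be an $n\times n$ real matrix all of whose eigenvalues (in $\mathbb{C}$) are real. If every eigenvector of $A$ is an eigenvector of $A^T$ (possibly associated with a different eigenvalue), then $A$ is symmetric, i.e., $A^T=A$.
   Context: $A^T$ denotes the transpose of $A$. An eigenvector of an $n\times n$ matrix $M$ is a nonzero vector $v\in\mathbb{C}^n$ such that $Mv=\lambda v$ for some $\lambda\in\mathbb{C}$; such a $\lambda$ is an eigenvalue of $M$. *)

(* Defs.v *)
From mathcomp Require Import all_boot all_order all_algebra.
From mathcomp Require Import complex.

Set Implicit Arguments.
Unset Strict Implicit.
Unset Printing Implicit Defensive.

Import GRing.Theory.
Local Open Scope ring_scope.

(* The predicate [eigenvalue] of mxalgebra is about row vectors
   ([v *m M = a *: v]); here eigenvectors are columns. *)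
Definition is_eigenvector (F : fieldType) (n : nat)
    (M : 'M[F]_n) (v : 'cV[F]_n) : Prop :=
  v != 0 /\ exists a : F, M *m v = a *: v.

Definition is_eigenvalue (F : fieldType) (n : nat)
    (M : 'M[F]_n) (a : F) : Prop :=
  exists v : 'cV[F]_n, v != 0 /\ M *m v = a *: v.

Definition complexify (R : rcfType) (m n : nat)
    (A : 'M[R]_(m, n)) : 'M[R[i]]_(m, n) :=
  map_mx (real_complex R) A.

(* Main.v *)
(** By Schur's theorem [A = P^* T P] with [P] unitary and [T] triangular, and
    the hypothesis passes to [T]: its eigenvectors are eigenvectors of [T^*].
    Some basis vector [e_k] is an eigenvector of [T], hence of [T^*], so row [k]
    of [T] vanishes off the diagonal, which makes the neighbouring basis vector
    an eigenvector of [T] in turn. Thus [T] is diagonal; its diagonal entries are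
    eigenvalues of [A], so they are real and [A] is Hermitian. *)

Require Import Defs.
From mathcomp Require Import all_boot all_order all_algebra.
From mathcomp Require Import complex.

Import GRing.Theory Num.Theory.
Local Open Scope ring_scope.
Local Open Scope sesquilinear_scope.

Lemma mulmx_delta_col (F : fieldType) (n : nat) (T : 'M[F]_n) (k : 'I_n) :
  (forall i, i != k -> T i k = 0) ->
  T *m delta_mx k 0 = T k k *: (delta_mx k 0 : 'cV_n).
Proof.
move=> Tk; rewrite -colE; apply/matrixP=> i j; rewrite !mxE ord1 eqxx andbT.
by have [->|/Tk ->] := eqVneq i k; rewrite ?mulr1 ?mulr0.
Qed.

Lemma delta_col_neq0 (F : fieldType) (n : nat) (k : 'I_n) :
  (delta_mx k 0 : 'cV[F]_n) != 0.
Proof.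
by apply/eqP=> /matrixP/(_ k 0); rewrite !mxE !eqxx; apply/eqP/oner_neq0.
Qed.

Lemma trig_eigenvector_diag (C : numClosedFieldType) (n : nat) (T : 'M[C]_n) :
  is_trig_mx T ->
  (forall v, is_eigenvector T v -> is_eigenvector (T ^t*) v) ->
  is_diag_mx T.
Proof.
move=> /is_trig_mxP Ttrig Teig; apply/is_diag_mxP.
suff rows m (k i : 'I_n) : (n - k <= m)%N -> i != k -> T k i = 0.
  by move=> k i ki; apply: (rows n); rewrite ?leq_subr // eq_sym.
(* [is_trig_mx] means lower triangular, so the rows are treated from the last
   one upwards. *)
elim: m k i => [|m IHm] k i.
  by rewrite leqn0 subn_eq0 leqNgt ltn_ord.
move=> le_nk_m ik.
have Tek : T *m delta_mx k 0 = T k k *: (delta_mx k 0 : 'cV_n).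
  apply: mulmx_delta_col => j jk.
  (* Above the diagonal, column [k] vanishes by triangularity; below it, because each row [j > k] is
     already known to be diagonal. *)
  have [/Ttrig //|lt_kj|eq_jk] := ltngtP j k.
    apply: IHm; last by rewrite eq_sym.
    by rewrite -ltnS (leq_trans _ le_nk_m) // ltn_sub2l.
  by rewrite (val_inj eq_jk) eqxx in jk.
have [|_ [b]] := Teig (delta_mx k 0).
  by split; [exact: delta_col_neq0 | exists (T k k)].
(* Entry [i] of [T ^t*] applied to [e_k] is the conjugate of [T k i], while entry [i] of [b *: e_k]
   is 0. *)
rewrite -colE => /matrixP/(_ i 0); rewrite !mxE (negbTE ik) mulr0.
by move/eqP; rewrite conjC_eq0 => /eqP.
Qed.

Lemma eigenvector_hermitian (C : numClosedFieldType) (n : nat) (A : 'M[C]_n) :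
  (forall a, is_eigenvalue A a -> a \is Num.real) ->
  (forall v, is_eigenvector A v -> is_eigenvector (A ^t*) v) ->
  A ^t* = A.
Proof.
(* [Schur] requires positive size, so the empty matrix is settled first. *)
case: n A => [|n] A Areal Aeig; first by rewrite [RHS]flatmx0 [LHS]flatmx0.
have [P Punitary] := Schur A isT.
rewrite /similar_to; set T := conjmx P A => Ttrig.
have PPt : P *m P ^t* = 1%:M by apply/unitarymxP.
have PtP : P ^t* *m P = 1%:M by apply: mulmx1C.
have TE : T = P *m A *m P ^t* by rewrite /T conjymx.
clearbody T.
have TtE : T ^t* = P *m A ^t* *m P ^t*.
  by rewrite TE !trmx_mul !map_mxM /= trmxCK mulmxA.
have AE : A = P ^t* *m T *m P.
  by rewrite TE !mulmxA PtP mul1mx -mulmxA PtP mulmx1.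
have AtE : A ^t* = P ^t* *m T ^t* *m P.
  by rewrite TtE !mulmxA PtP mul1mx -mulmxA PtP mulmx1.
have Pt0 (v : 'cV_n.+1) : v != 0 -> P ^t* *m v != 0.
  apply: contraNneq => Ptv0.
  by rewrite -[v]mul1mx -PPt -mulmxA Ptv0 mulmx0.
have APt (v : 'cV_n.+1) a : T *m v = a *: v ->
    A *m (P ^t* *m v) = a *: (P ^t* *m v).
  move=> Tv; rewrite {1}AE -!mulmxA (mulmxA P) PPt mul1mx Tv.
  by rewrite -scalemxAr.
have Tdiag : is_diag_mx T.
  apply: trig_eigenvector_diag => // v [v0 [a Tv]]; split=> //.
  (* Carry [v] to an eigenvector of [A], apply the hypothesis there, and carry the result back by
     [P]. *)
  have [|_ [b Atb]] := Aeig (P ^t* *m v).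
    by split; [exact: Pt0 | exists a; exact: APt].
  by exists b; rewrite TtE -!mulmxA Atb -scalemxAr mulmxA PPt mul1mx.
have /is_diag_mxP T0 := Tdiag.
suff TtT : T ^t* = T by rewrite AtE TtT -AE.
apply/matrixP=> i j; rewrite !mxE.
have [->|ij] := eqVneq i j; last by rewrite !T0 ?conjC0 // eq_sym.
(* [T] being diagonal, [e_j] has eigenvalue [T j j], and its image under [P ^t*] is an eigenvector
   of [A] for the same value. *)
apply/CrealP/Areal; exists (P ^t* *m delta_mx j 0).
split; first exact/Pt0/delta_col_neq0.
by apply/APt/mulmx_delta_col => k kj; rewrite T0.
Qed.

Theorem corollary1 (R : rcfType) (n : nat) (A : 'M[R]_n)
  (hreal : forall a : R[i], is_eigenvalue (complexify A) a -> a \is Num.real)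
  (heig : forall v : 'cV[R[i]]_n,
     is_eigenvector (complexify A) v -> is_eigenvector (complexify A^T) v) :
  A^T = A.
Proof.
(* Conjugation fixes the real entries, so the Hermitian statement specializes to the transpose. *)
have AtE : (complexify A) ^t* = complexify A^T.
  apply/matrixP=> i j; rewrite !mxE.
  by apply/CrealP/complex_realP; exists (A j i).
suff: complexify A^T = complexify A by apply: map_mx_inj; apply: complexI.
by rewrite -AtE; apply: eigenvector_hermitian => // v; rewrite AtE; apply: heig.
Qed.
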